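(* Let $\mathbb{H}_4$ be the Sweedler Hopf algebra over $\mathbb{R}$ with basis $1,g,\nu,g\nu$, and let $\mathbb{H}_{00}$ be the $\frac14$-quaternion algebra over $\mathbb{R}$ with basis $1,e_1,e_2,e_3$. Let $k_1,k_2,k_3,l_1,l_2,l_3,l_4\in\mathbb{R}$ be arbitrary parameters. Define a linear map $\cdot:\mathbb{H}_4\otimes\mathbb{H}_{00}\to\mathbb{H}_{00}$ on basis elements by: - $1\cdot 1=1$, $1\cdot e_i=e_i$ for $i=1,2,3$; - $g\cdot 1=g\cdot e_1=g\cdot e_2=g\cdot e_3=0$; - $\nu\cdot 1=k_1e_1+k_2e_2+k_3e_3$, $\nu\cdot e_1=-k_2e_3$, $\nu\cdot e_2=k_1e_3$, $\nu\cdot e_3=0$; - $g\nu\cdot 1=l_1 1+l_2e_1+l_3e_2+l_4e_3$, $g\nu\cdot e_1=l_1e_1+l_3e_3$, $g\nu\cdot e_2=l_1e_2-l_2e_3$, $g\nu\cdot e_3=l_1e_3$. Define a linear map $\omega:\mathbb{H}_4\otimes\mathbb{H}_4\to\mathbb{H}_{00}$, writing $\omega(h,l)=\omega(h\otimes l)$, on basis elements by: - $\omega(1,1)=1$, $\omega(1,g)=0$, $\omega(1,\nu)=k_1e_1+k_2e_2+k_3e_3$, $\omega(1,g\nu)=l_1 1+l_2e_1+l_3e_2+l_4e_3$; - $\omega(g,1)=\omega(g,g)=\omega(g,\nu)=\omega(g,g\nu)=0$; - $\omega(\nu,1)=k_1e_1+k_2e_2+k_3e_3$, $\omega(\nu,g)=\omega(\nu,\nu)=0$,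 $\omega(\nu,g\nu)=k_1l_1e_1+k_2l_1e_2+(k_3l_1-k_2l_2+k_1l_3)e_3$; - $\omega(g\nu,1)=l_1 1+l_2e_1+l_3e_2+l_4e_3$, $\omega(g\nu,g)=\omega(g\nu,g\nu)=0$, $\omega(g\nu,\nu)=k_1l_1e_1+k_2l_1e_2+(k_3l_1-k_2l_2+k_1l_3)e_3$. Then the pair $(\cdot,\omega)$ is a twisted partial action of $\mathbb{H}_4$ on $\mathbb{H}_{00}$.
   Context: All algebras, tensor products and linear maps are over $\mathbb{R}$. Sweedler notation $\Delta(h)=h_1\otimes h_2$ (summation suppressed) is used. Sweedler Hopf algebra $\mathbb{H}_4$: generated by $g,\nu$ with $g^2=1$, $\nu^2=0$, $g\nu+\nu g=0$; $\Delta(g)=g\otimes g$, $\Delta(\nu)=g\otimes\nu+\nu\otimes 1$, $\varepsilon(g)=1$, $\varepsilon(\nu)=0$, $S(g)=g$, $S(\nu)=-g\nu$. It is $4$-dimensional with basis $1,g,\nu,g\nu$. $\frac14$-quaternion algebra $\mathbb{H}_{00}$: the unital associative $\mathbb{R}$-algebra with basis $1,e_1,e_2,e_3$ and $e_1^2=e_2^2=e_3^2=0$, $e_1e_2=e_3=-e_2e_1$, $e_2e_3=0=e_3e_2$, $e_3e_1=0=e_1e_3$. Twisted partial action: let $H$ be a Hopf algebra and $A$ a unital algebra with unit $1_A$. A pair of linear maps $\cdot:H\otimes A\to A$ and $\omega:H\otimes H\to A$ (with $\omega(h,l)=\omega(h\otimes l)$) is a twisted partial action of $H$ on $A$ if for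 all $a,b\in A$ and $h,l\in H$: (1) $1_H\cdot a=a$; (2) $h\cdot(ab)=(h_1\cdot a)(h_2\cdot b)$; (3) $(h_1\cdot(l_1\cdot a))\,\omega(h_2,l_2)=\omega(h_1,l_1)\,(h_2l_2\cdot a)$; (4) $\omega(h,l)=\omega(h_1,l_1)\,(h_2l_2\cdot 1_A)$. *)

(* Defs.v *)
From HB Require Import structures.
From mathcomp Require Import all_boot all_order all_algebra.
From mathcomp Require Import boolp reals.
From mathcomp Require Import ring.

Set Implicit Arguments.
Unset Strict Implicit.
Unset Printing Implicit Defensive.

Import GRing.Theory.
Local Open Scope ring_scope.
Local Open Scope quotient_scope.

Notation bilinear_map f := (bilinear_for *:%R *:%R f).

(** A formal sum [s : seq (U * V)] stands for the sum of the [p.1 (x) p.2] with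
    [p] in [s] (scalars are absorbed in the first factor); two formal sums are
    the same tensor when no bilinear map distinguishes them. *)

Section TensorProduct.
Variables (R : comNzRingType) (U V : lmodType R).

Definition tens_eqv (s t : seq (U * V)) : bool :=
  `[< forall (W : lmodType R) (f : U -> V -> W), bilinear_map f ->
      \sum_(p <- s) f p.1 p.2 = \sum_(p <- t) f p.1 p.2 >].

Lemma tens_eqv_refl : reflexive tens_eqv.
Proof. by move=> s; apply/asboolP. Qed.

Lemma tens_eqv_sym : symmetric tens_eqv.
Proof.
by move=> s t; apply/asboolP/asboolP => st W f fB; rewrite (st W f fB).
Qed.

Lemma tens_eqv_trans : transitive tens_eqv.
Proof.
move=> t s u /asboolP st /asboolP tu; apply/asboolP => W f fB.
by rewrite (st W f fB) (tu W f fB).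
Qed.

Canonical tens_eqv_equiv :=
  EquivRel tens_eqv tens_eqv_refl tens_eqv_sym tens_eqv_trans.

Definition tensor : Type := {eq_quot tens_eqv}.

HB.instance Definition _ := Choice.copy tensor {eq_quot tens_eqv}.
HB.instance Definition _ := EqQuotient.copy tensor {eq_quot tens_eqv}.

Definition tens (u : U) (v : V) : tensor := \pi_tensor [:: (u, v)].

(** For [f] bilinear, [tens_lift f t] is the image of [t] under the linear map
    induced by [f], that is, the Sweedler sum of [f t_1 t_2] (see [tens_liftE]
    and [tens_lift_tens]). *)
Definition tens_lift (W : lmodType R) (f : U -> V -> W) (t : tensor) : W :=
  \sum_(p <- repr t) f p.1 p.2.

Lemma tens_liftE (W : lmodType R) (f : U -> V -> W) (s : seq (U * V)) :
  bilinear_map f -> tens_lift f (\pi_tensor s) = \sum_(p <- s) f p.1 p.2.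
Proof.
move=> fB; rewrite /tens_lift.
have /eqmodP/asboolP st : repr (\pi_tensor s) = s %[mod tensor] by rewrite reprK.
exact: st.
Qed.

Lemma tens_lift_tens (W : lmodType R) (f : U -> V -> W) u v :
  bilinear_map f -> tens_lift f (tens u v) = f u v.
Proof. by move=> fB; rewrite tens_liftE// big_seq1. Qed.

Lemma tensP (s t : tensor) :
  (forall (W : lmodType R) (f : U -> V -> W), bilinear_map f ->
     tens_lift f s = tens_lift f t) -> s = t.
Proof. by move=> st; rewrite -[s]reprK -[t]reprK; apply/eqmodP/asboolP. Qed.

Definition tens_zero : tensor := \pi_tensor [::].
Definition tens_add (s t : tensor) : tensor := \pi_tensor (repr s ++ repr t).
Definition tens_scale (a : R) (t : tensor) : tensor :=
  \pi_tensor [seq (a *: p.1, p.2) | p <- repr t].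
Definition tens_opp : tensor -> tensor := tens_scale (-1).

Section TensorOps.
Variables (W : lmodType R) (f : U -> V -> W).
Hypothesis fB : bilinear_map f.

Lemma tens_lift_zero : tens_lift f tens_zero = 0.
Proof. by rewrite tens_liftE// big_nil. Qed.

Lemma tens_lift_add s t :
  tens_lift f (tens_add s t) = tens_lift f s + tens_lift f t.
Proof. by rewrite tens_liftE// big_cat. Qed.

Lemma tens_lift_scale a t : tens_lift f (tens_scale a t) = a *: tens_lift f t.
Proof.
rewrite tens_liftE// big_map scaler_sumr; apply: eq_bigr => p _ /=.
exact: (scalable_linear (fB.1 p.2)).
Qed.

Definition tens_liftop := (tens_lift_zero, tens_lift_add, tens_lift_scale).
End TensorOps.

Lemma tens_addA : associative tens_add.
Proof. by move=> s t u; apply: tensP => W f fB; rewrite !tens_liftop// addrA. Qed.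

Lemma tens_addC : commutative tens_add.
Proof. by move=> s t; apply: tensP => W f fB; rewrite !tens_liftop// addrC. Qed.

Lemma tens_add0 : left_id tens_zero tens_add.
Proof. by move=> s; apply: tensP => W f fB; rewrite !tens_liftop// add0r. Qed.

Lemma tens_addN : left_inverse tens_zero tens_opp tens_add.
Proof.
by move=> s; apply: tensP => W f fB; rewrite !tens_liftop// scaleN1r addNr.
Qed.

HB.instance Definition _ :=
  GRing.isZmodule.Build tensor tens_addA tens_addC tens_add0 tens_addN.

Lemma tens_scaleA a b t : tens_scale a (tens_scale b t) = tens_scale (a * b) t.
Proof. by apply: tensP => W f fB; rewrite !tens_liftop// scalerA. Qed.

Lemma tens_scale1 : left_id 1 tens_scale.
Proof. by move=> s; apply: tensP => W f fB; rewrite !tens_liftop// scale1r. Qed.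

Lemma tens_scaleDr : right_distributive tens_scale +%R.
Proof.
by move=> a s t; apply: tensP => W f fB; rewrite !tens_liftop// scalerDr.
Qed.

Lemma tens_scaleDl t : {morph tens_scale^~ t : a b / a + b}.
Proof.
by move=> a b; apply: tensP => W f fB; rewrite !tens_liftop// scalerDl.
Qed.

HB.instance Definition _ := GRing.Zmodule_isLmodule.Build R tensor
  tens_scaleA tens_scale1 tens_scaleDr tens_scaleDl.

Lemma tens_lift_linear (W : lmodType R) (f : U -> V -> W) :
  bilinear_map f -> linear (tens_lift f).
Proof.
by move=> fB a s t; rewrite [LHS]tens_lift_add// [X in X + _]tens_lift_scale.
Qed.

Lemma bilinear_mapP (W : lmodType R) (f : {bilinear U -> V -> W}) :
  bilinear_map f.
Proof. by split=> [v | u] a x y; [rewrite linearPl | rewrite linearPr]. Qed.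

Lemma tens_lift_fun (W : lmodType R) a (f1 f2 : U -> V -> W) t :
  tens_lift (fun x y => a *: f1 x y + f2 x y) t
    = a *: tens_lift f1 t + tens_lift f2 t.
Proof. by rewrite /tens_lift scaler_sumr -big_split. Qed.

HB.instance Definition _ (W : lmodType R) (f : {bilinear U -> V -> W}) :=
  GRing.isLinear.Build R tensor W *:%R (tens_lift f)
    (tens_lift_linear (bilinear_mapP f)).

Lemma tens_bilinear : bilinear_map tens.
Proof.
split=> [v | u] a x y; apply: tensP => W f fB.
  by rewrite (tens_lift_linear fB) !tens_lift_tens// fB.1.
by rewrite (tens_lift_linear fB) !tens_lift_tens// fB.2.
Qed.

HB.instance Definition _ := bilinear_isBilinear.Build R U V tensor *:%R *:%R
  tens tens_bilinear.

End TensorProduct.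

Notation "U ⊗ V" := (tensor U V)
  (at level 40, left associativity) : type_scope.
Notation "u ⊗ v" := (tens u v) (at level 40, left associativity) : ring_scope.

Notation "'\sw_' ( x , y <- t ) E" := (tens_lift (fun x y => E) t)
  (at level 41, x name, y name, t at level 60, E at level 41,
   format "'\sw_' ( x ,  y  <-  t )  E") : ring_scope.

HB.mixin Record hasHopf (R : comNzRingType) H of GRing.Algebra R H := {
  comul : {linear H -> (H ⊗ H)%type};
  counit : {scalar H};
  antipode : {linear H -> H};
  comulA : forall h,
    \sw_(h1, h2 <- comul h) \sw_(h11, h12 <- comul h1) (h11 ⊗ (h12 ⊗ h2)) =
    \sw_(h1, h2 <- comul h) (h1 ⊗ comul h2);
  counitl : forall h, \sw_(h1, h2 <- comul h) (counit h1 *: h2) = h;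
  counitr : forall h, \sw_(h1, h2 <- comul h) (counit h2 *: h1) = h;
  comul1 : comul 1 = 1 ⊗ 1;
  comulM : forall h l, comul (h * l) =
    \sw_(h1, h2 <- comul h) \sw_(l1, l2 <- comul l) ((h1 * l1) ⊗ (h2 * l2));
  counit1 : counit 1 = 1;
  counitM : forall h l, counit (h * l) = counit h * counit l;
  antipodel : forall h, \sw_(h1, h2 <- comul h) (antipode h1 * h2) = (counit h)%:A :> H;
  antipoder : forall h, \sw_(h1, h2 <- comul h) (h1 * antipode h2) = (counit h)%:A :> H
}.

#[short(type="hopfType")]
HB.structure Definition Hopf (R : comNzRingType) :=
  {H of GRing.Algebra R H & hasHopf R H}.

Section TwistedPartialAction.
Variables (R : comNzRingType) (H : hopfType R) (A : algType R).
Variables (act : {linear (H ⊗ A)%type -> A}) (omega : {linear (H ⊗ H)%type -> A}).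

Local Notation "h ▷ a" := (act (h ⊗ a)) (at level 38, right associativity).
Local Notation ω h l := (omega (h ⊗ l)).
Local Notation Δ := (@comul R H).

Record twisted_partial_action : Prop := TwistedPartialAction {
  tpa_unit : forall a : A, 1 ▷ a = a;
  tpa_mul : forall (h : H) (a b : A),
    h ▷ (a * b) = \sw_(h1, h2 <- Δ h) ((h1 ▷ a) * (h2 ▷ b));
  tpa_twist : forall (h l : H) (a : A),
    \sw_(h1, h2 <- Δ h) \sw_(l1, l2 <- Δ l) ((h1 ▷ l1 ▷ a) * ω h2 l2) =
    \sw_(h1, h2 <- Δ h) \sw_(l1, l2 <- Δ l) (ω h1 l1 * ((h2 * l2) ▷ a));
  tpa_cocycle : forall h l : H,
    ω h l = \sw_(h1, h2 <- Δ h) \sw_(l1, l2 <- Δ l) (ω h1 l1 * ((h2 * l2) ▷ 1))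
}.

End TwistedPartialAction.

Section Tables.
Variables (R : comNzRingType) (W : lmodType R).

Definition lin_table n (t : seq W) (x : 'rV[R]_n) : W :=
  \sum_(i < n) x 0 i *: t`_i.

Lemma lin_table_is_linear n t : linear (@lin_table n t).
Proof.
move=> a x y; rewrite /lin_table scaler_sumr -big_split; apply: eq_bigr => i _.
by rewrite !mxE scalerDl scalerA.
Qed.

HB.instance Definition _ n t := GRing.isLinear.Build R 'rV[R]_n W *:%R
  (@lin_table n t) (lin_table_is_linear t).

Definition bilin_table m n (t : seq (seq W)) (x : 'rV[R]_m) (y : 'rV[R]_n) : W :=
  \sum_(i < m) \sum_(j < n) (x 0 i * y 0 j) *: (nth [::] t i)`_j.

Lemma bilin_table_is_bilinear m n t : bilinear_map (@bilin_table m n t).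
Proof.
split=> [y | x] a u v; rewrite /bilin_table /= scaler_sumr -big_split /=;
  apply: eq_bigr => i _; rewrite scaler_sumr -big_split /=;
  apply: eq_bigr => j _; rewrite !mxE scalerA -scalerDl; congr (_ *: _); ring.
Qed.

HB.instance Definition _ m n t :=
  bilinear_isBilinear.Build R 'rV[R]_m 'rV[R]_n W *:%R *:%R
    (@bilin_table m n t) (@bilin_table_is_bilinear m n t).

Lemma lin_table_delta n t (i : 'I_n) : lin_table t (delta_mx 0 i) = t`_i.
Proof.
rewrite /lin_table (bigD1 i)//= big1 ?addr0 ?mxE ?eqxx ?scale1r// => j ji.
by rewrite !mxE eqxx /= (negbTE ji) scale0r.
Qed.

Lemma bilin_table_delta m n t (i : 'I_m) (j : 'I_n) :
  bilin_table t (delta_mx 0 i) (delta_mx 0 j) = (nth [::] t i)`_j.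
Proof.
rewrite /bilin_table (bigD1 i)//= [X in _ + X]big1 ?addr0 => [|k ki]; last first.
  by rewrite big1// => l _; rewrite !mxE eqxx /= (negbTE ki) mul0r scale0r.
rewrite (bigD1 j)//= big1 ?addr0 ?mxE ?eqxx ?mulr1 ?scale1r// => l lj.
by rewrite !mxE eqxx /= (negbTE lj) mulr0 scale0r.
Qed.

Lemma linear_row_eq n (f g : 'rV[R]_n -> W) : linear f -> linear g ->
  (forall i, f (delta_mx 0 i) = g (delta_mx 0 i)) -> f =1 g.
Proof.
move=> fL gL fg x; pose F := GRing.isLinear.Build _ _ _ _ f fL.
pose G := GRing.isLinear.Build _ _ _ _ g gL.
pose f' : {linear 'rV[R]_n -> W} := HB.pack f F.
pose g' : {linear 'rV[R]_n -> W} := HB.pack g G.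
rewrite -[f]/(f' : _ -> _) -[g]/(g' : _ -> _) [x]row_sum_delta !linear_sum.
by apply: eq_bigr => i _; rewrite !linearZ /= fg.
Qed.

End Tables.

Notation ord4 i := (@Ordinal 4 i isT).

Lemma ord4P (P : 'I_4 -> Prop) :
  P (ord4 0) -> P (ord4 1) -> P (ord4 2) -> P (ord4 3) -> forall i, P i.
Proof.
move=> P0 P1 P2 P3 [[|[|[|[|//]]]] lti];
  by [have <- : ord4 0 = Ordinal lti by apply: val_inj
     |have <- : ord4 1 = Ordinal lti by apply: val_inj
     |have <- : ord4 2 = Ordinal lti by apply: val_inj
     |have <- : ord4 3 = Ordinal lti by apply: val_inj].
Qed.

Lemma sum_ord4 (V : nmodType) (F : 'I_4 -> V) :
  \sum_(i < 4) F i = F (ord4 0) + F (ord4 1) + F (ord4 2) + F (ord4 3).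
Proof.
rewrite !big_ord_recl big_ord0 addr0 !addrA.
by congr (F _ + F _ + F _ + F _); apply: val_inj.
Qed.

(** Coordinates are with respect to the basis [1, g, ν, gν]; the values of the
    structure maps on [gν] follow from those on [g] and [ν]. *)

Definition sweedlerH4 (R : comNzRingType) : Type := 'rV[R]_4.

Section SweedlerH4Algebra.
Variable R : comNzRingType.
Local Notation H4 := (sweedlerH4 R).

HB.instance Definition _ := GRing.Lmodule.copy H4 'rV[R]_4.

Definition h4_one : H4 := delta_mx 0 (ord4 0).
Definition h4_g : H4 := delta_mx 0 (ord4 1).
Definition h4_nu : H4 := delta_mx 0 (ord4 2).
Definition h4_gnu : H4 := delta_mx 0 (ord4 3).

Local Notation g := h4_g.
Local Notation ν := h4_nu.
Local Notation gν := h4_gnu.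

Definition h4_mul : H4 -> H4 -> H4 := bilin_table
  [:: [:: h4_one;   g; ν; gν];
      [::      g; h4_one; gν; ν];
      [::      ν; - gν; 0; 0];
      [::     gν; - ν; 0; 0]].

Lemma h4_mulE (x y : H4) : h4_mul x y = \row_i
  [:: x 0 (ord4 0) * y 0 (ord4 0) + x 0 (ord4 1) * y 0 (ord4 1);
      x 0 (ord4 0) * y 0 (ord4 1) + x 0 (ord4 1) * y 0 (ord4 0);
      x 0 (ord4 0) * y 0 (ord4 2) + x 0 (ord4 1) * y 0 (ord4 3)
      + x 0 (ord4 2) * y 0 (ord4 0) - x 0 (ord4 3) * y 0 (ord4 1);
      x 0 (ord4 0) * y 0 (ord4 3) + x 0 (ord4 1) * y 0 (ord4 2)
      - x 0 (ord4 2) * y 0 (ord4 1) + x 0 (ord4 3) * y 0 (ord4 0)]`_i.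
Proof.
rewrite /h4_mul /bilin_table !sum_ord4 /=.
by apply/rowP; apply: ord4P; rewrite !mxE /=; ring.
Qed.

Lemma h4_mulA : associative h4_mul.
Proof.
move=> x y z; rewrite !h4_mulE.
by apply/rowP; apply: ord4P; rewrite !mxE /=; ring.
Qed.

Lemma h4_mul1 : left_id h4_one h4_mul.
Proof.
move=> x; rewrite !h4_mulE.
by apply/rowP; apply: ord4P; rewrite !mxE /=; ring.
Qed.

Lemma h4_mulr1 : right_id h4_one h4_mul.
Proof.
move=> x; rewrite !h4_mulE.
by apply/rowP; apply: ord4P; rewrite !mxE /=; ring.
Qed.

Lemma h4_mulDl : left_distributive h4_mul +%R.
Proof. by move=> x y z; rewrite /h4_mul linearDl. Qed.

Lemma h4_mulDr : right_distributive h4_mul +%R.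
Proof. by move=> x y z; rewrite /h4_mul linearDr. Qed.

Lemma h4_one_neq0 : h4_one != 0.
Proof. by apply/eqP => /rowP/(_ (ord4 0))/eqP; rewrite !mxE /= oner_eq0. Qed.

HB.instance Definition _ := GRing.Zmodule_isNzRing.Build H4
  h4_mulA h4_mul1 h4_mulr1 h4_mulDl h4_mulDr h4_one_neq0.

Lemma h4_scaleAl (a : R) (x y : H4) : a *: (x * y) = (a *: x) * y.
Proof. by rewrite -[RHS]/(h4_mul _ _) /h4_mul linearZl_LR. Qed.

HB.instance Definition _ := GRing.Lmodule_isLalgebra.Build R H4 h4_scaleAl.

Lemma h4_scaleAr (a : R) (x y : H4) : a *: (x * y) = x * (a *: y).
Proof. by rewrite -[RHS]/(h4_mul _ _) /h4_mul linearZr_LR. Qed.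

HB.instance Definition _ := GRing.Lalgebra_isAlgebra.Build R H4 h4_scaleAr.

End SweedlerH4Algebra.

Section SweedlerH4Hopf.
Variable R : comNzRingType.
Local Notation H4 := (sweedlerH4 R).
Local Notation g := (h4_g R).
Local Notation ν := (h4_nu R).
Local Notation gν := (h4_gnu R).

Definition h4_comul : {linear H4 -> (H4 ⊗ H4)%type} :=
  @lin_table R (H4 ⊗ H4)%type 4
    [:: 1 ⊗ 1; g ⊗ g; g ⊗ ν + ν ⊗ 1; 1 ⊗ gν + gν ⊗ g].

Definition h4_counit (h : H4) : R := @lin_table R R^o 4 [:: 1; 1; 0; 0] h.

HB.instance Definition _ := GRing.isLinear.Build R H4 R *%R h4_counit
  (@lin_table_is_linear R R^o 4 [:: 1; 1; 0; 0]).

Definition h4_antipode : {linear H4 -> H4} :=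
  @lin_table R H4 4 [:: 1; g; - gν; ν].

Lemma h4_mul_basis : [/\ [/\ g * g = 1, g * ν = gν & g * gν = ν],
  [/\ ν * g = - gν, ν * ν = 0 & ν * gν = 0] &
  [/\ gν * g = - ν, gν * ν = 0 & gν * gν = 0]].
Proof. by do ?split; apply: etrans (bilin_table_delta _ _ _) _. Qed.

Lemma h4_sw (W : lmodType R) (f : H4 -> H4 -> W) (h : H4) : bilinear_map f ->
  tens_lift f (h4_comul h) =
    h 0 (ord4 0) *: f 1 1 + h 0 (ord4 1) *: f g g
    + h 0 (ord4 2) *: (f g ν + f ν 1) + h 0 (ord4 3) *: (f 1 gν + f gν g).
Proof.
move=> fB; rewrite /h4_comul /= /lin_table sum_ord4 /=.
have fD s t : tens_lift f (s + t) = tens_lift f s + tens_lift f t.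
  by rewrite -[s]scale1r (tens_lift_linear fB) !scale1r.
have fZ a s : tens_lift f (a *: s) = a *: tens_lift f s.
  have f0 : tens_lift f 0 = 0 by apply: tens_lift_zero.
  by rewrite -[a *: s]addr0 (tens_lift_linear fB) f0 addr0.
by rewrite !(fD, fZ) !tens_lift_tens.
Qed.

Lemma h4_sw_basis (W : lmodType R) (f : H4 -> H4 -> W) : bilinear_map f ->
  [/\ tens_lift f (h4_comul 1) = f 1 1,
      tens_lift f (h4_comul g) = f g g,
      tens_lift f (h4_comul ν) = f g ν + f ν 1 &
      tens_lift f (h4_comul gν) = f 1 gν + f gν g].
Proof.
move=> fB; rewrite !h4_sw//; split; rewrite !mxE /=;
by rewrite ?(scale0r, scale1r, add0r, addr0).
Qed.

Lemma h4_linear_eq (W : lmodType R) (F G : H4 -> W) : linear F -> linear G ->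
  F 1 = G 1 -> F g = G g -> F ν = G ν -> F gν = G gν -> F =1 G.
Proof. by move=> FL GL *; apply: (@linear_row_eq R W 4) => //; apply: ord4P. Qed.

Lemma h4_sw_linear (W : lmodType R) (f : H4 -> H4 -> W) :
  bilinear_map f -> linear (fun h => tens_lift f (h4_comul h)).
Proof. by move=> fB a x y /=; rewrite linearP (tens_lift_linear fB). Qed.

Lemma bilinear_counitl : bilinear_map (fun h1 h2 : H4 => h4_counit h1 *: h2).
Proof.
split=> u a x y /=.
  by rewrite linearP scalerDl -scalerA.
by rewrite scalerDr !scalerA mulrC.
Qed.

Lemma bilinear_counitr : bilinear_map (fun h1 h2 : H4 => h4_counit h2 *: h1).
Proof.
split=> u a x y /=.
  by rewrite scalerDr !scalerA mulrC.
by rewrite linearP scalerDl -scalerA.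
Qed.

Lemma h4_counit_basis :
  [/\ h4_counit 1 = 1, h4_counit g = 1, h4_counit ν = 0 & h4_counit gν = 0].
Proof.
split; rewrite /h4_counit /lin_table sum_ord4 /= !mxE /= /GRing.scale /=; ring.
Qed.

Lemma h4_antipode_basis : [/\ h4_antipode 1 = 1, h4_antipode g = g,
  h4_antipode ν = - gν & h4_antipode gν = ν].
Proof. by split; apply: etrans (lin_table_delta _ _) _. Qed.

Lemma h4_comul_basis : [/\ h4_comul 1 = 1 ⊗ 1, h4_comul g = g ⊗ g,
  h4_comul ν = g ⊗ ν + ν ⊗ 1 & h4_comul gν = 1 ⊗ gν + gν ⊗ g].
Proof. by split; apply: etrans (lin_table_delta _ _) _. Qed.

Lemma h4_counitl h : \sw_(h1, h2 <- h4_comul h) (h4_counit h1 *: h2) = h.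
Proof.
have fB := bilinear_counitl; have [c1 cg cn cgn] := h4_counit_basis.
have [b1 bg bn bgn] := h4_sw_basis fB.
apply: (h4_linear_eq (h4_sw_linear fB) (G := id)) => //=;
  rewrite ?(b1, bg, bn, bgn) ?(c1, cg, cn, cgn);
  by rewrite ?(scale0r, scale1r, add0r, addr0).
Qed.

Lemma h4_counitr h : \sw_(h1, h2 <- h4_comul h) (h4_counit h2 *: h1) = h.
Proof.
have fB := bilinear_counitr; have [c1 cg cn cgn] := h4_counit_basis.
have [b1 bg bn bgn] := h4_sw_basis fB.
apply: (h4_linear_eq (h4_sw_linear fB) (G := id)) => //=;
  rewrite ?(b1, bg, bn, bgn) ?(c1, cg, cn, cgn);
  by rewrite ?(scale0r, scale1r, add0r, addr0).
Qed.

Lemma h4_antipodel h :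
  \sw_(h1, h2 <- h4_comul h) (h4_antipode h1 * h2) = (h4_counit h)%:A :> H4.
Proof.
have fB : bilinear_map (fun h1 h2 : H4 => h4_antipode h1 * h2).
  split=> u a x y /=; first by rewrite linearP mulrDl scalerAl.
  by rewrite mulrDr scalerAr.
have [c1 cg cn cgn] := h4_counit_basis.
have [s1 sg sn sgn] := h4_antipode_basis.
have [[gg gn g_gn] [ng nn n_gn] [gn_g gn_n gn_gn]] := h4_mul_basis.
have [b1 bg bn bgn] := h4_sw_basis fB.
apply: (h4_linear_eq (h4_sw_linear fB) (G := fun h => (h4_counit h)%:A : H4)) => /=.
- by move=> a x y; rewrite linearP scalerDl -scalerA.
- by rewrite b1 c1 s1 mulr1 scale1r.
- by rewrite bg cg sg gg scale1r.
- by rewrite bn cn sg sn mulr1 scale0r gn subrr.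
- by rewrite bgn cgn sgn s1 mul1r scale0r ng subrr.
Qed.

Lemma h4_antipoder h :
  \sw_(h1, h2 <- h4_comul h) (h1 * h4_antipode h2) = (h4_counit h)%:A :> H4.
Proof.
have fB : bilinear_map (fun h1 h2 : H4 => h1 * h4_antipode h2).
  split=> u a x y /=; first by rewrite mulrDl scalerAl.
  by rewrite linearP mulrDr scalerAr.
have [c1 cg cn cgn] := h4_counit_basis.
have [s1 sg sn sgn] := h4_antipode_basis.
have [[gg gn g_gn] [ng nn n_gn] [gn_g gn_n gn_gn]] := h4_mul_basis.
have [b1 bg bn bgn] := h4_sw_basis fB.
apply: (h4_linear_eq (h4_sw_linear fB) (G := fun h => (h4_counit h)%:A : H4)) => /=.
- by move=> a x y; rewrite linearP scalerDl -scalerA.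
- by rewrite b1 c1 s1 mulr1 scale1r.
- by rewrite bg cg sg gg scale1r.
- by rewrite bn cn sn s1 mulr1 scale0r mulrN g_gn addNr.
- by rewrite bgn cgn sgn sg mul1r scale0r gn_g subrr.
Qed.

Lemma h4_comulA h :
  \sw_(h1, h2 <- h4_comul h) \sw_(h11, h12 <- h4_comul h1)
    (h11 ⊗ (h12 ⊗ h2)) =
  \sw_(h1, h2 <- h4_comul h) (h1 ⊗ h4_comul h2).
Proof.
have iB (z : H4) : bilinear_map (fun x y : H4 => x ⊗ (y ⊗ z)).
  by split=> u a x y /=; rewrite ?linearPl ?linearPr.
have fB : bilinear_map (fun h1 h2 : H4 =>
    \sw_(h11, h12 <- h4_comul h1) (h11 ⊗ (h12 ⊗ h2))).
  split=> u a x y /=; first exact: (h4_sw_linear (iB u)).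
  rewrite -tens_lift_fun; congr tens_lift.
  by apply/funext => p; apply/funext => q; rewrite !linearPr.
have gB : bilinear_map (fun h1 h2 : H4 => h1 ⊗ h4_comul h2).
  by split=> u a x y /=; rewrite ?linearPl// linearP linearPr.
have [b1 bg bn bgn] := h4_sw_basis fB.
have [d1 dg dn dgn] := h4_sw_basis gB.
have [D1 Dg Dn Dgn] := h4_comul_basis.
have e1 z := let: And4 e _ _ _ := h4_sw_basis (iB z) in e.
have eg z := let: And4 _ e _ _ := h4_sw_basis (iB z) in e.
have en z := let: And4 _ _ e _ := h4_sw_basis (iB z) in e.
have egn z := let: And4 _ _ _ e := h4_sw_basis (iB z) in e.
apply: (h4_linear_eq (h4_sw_linear fB) (h4_sw_linear gB)).
- by rewrite b1 d1 e1 D1.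
- by rewrite bg dg eg Dg.
- by rewrite bn dn eg en Dn D1 linearDr !addrA.
- by rewrite bgn dgn e1 egn Dgn Dg linearDr !addrA.
Qed.

Lemma h4_comul1 : h4_comul 1 = 1 ⊗ 1.
Proof. by case: h4_comul_basis. Qed.

Lemma h4_comulM h l : h4_comul (h * l) =
  \sw_(h1, h2 <- h4_comul h) \sw_(l1, l2 <- h4_comul l)
    ((h1 * l1) ⊗ (h2 * l2)).
Proof.
have iB (x y : H4) : bilinear_map (fun l1 l2 : H4 => (x * l1) ⊗ (y * l2)).
  by split=> u a v w /=; rewrite mulrDr -scalerAr ?linearPl ?linearPr.
have fB (m : H4) : bilinear_map (fun h1 h2 : H4 =>
    \sw_(l1, l2 <- h4_comul m) ((h1 * l1) ⊗ (h2 * l2))).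
  split=> u a x y /=; rewrite -tens_lift_fun; congr tens_lift;
    apply/funext => p; apply/funext => q;
    by rewrite mulrDl -scalerAl ?linearPl ?linearPr.
have [D1 Dg Dn Dgn] := h4_comul_basis.
have [[gg gn g_gn] [ng nn n_gn] [gn_g gn_n gn_gn]] := h4_mul_basis.
have b1 m := let: And4 e _ _ _ := h4_sw_basis (fB m) in e.
have bg m := let: And4 _ e _ _ := h4_sw_basis (fB m) in e.
have bn m := let: And4 _ _ e _ := h4_sw_basis (fB m) in e.
have bgn m := let: And4 _ _ _ e := h4_sw_basis (fB m) in e.
have e1 x y := let: And4 e _ _ _ := h4_sw_basis (iB x y) in e.
have eg x y := let: And4 _ e _ _ := h4_sw_basis (iB x y) in e.
have en x y := let: And4 _ _ e _ := h4_sw_basis (iB x y) in e.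
have egn x y := let: And4 _ _ _ e := h4_sw_basis (iB x y) in e.
have L1 m : linear (fun h : H4 => h4_comul (h * m)).
  by move=> a x y; rewrite mulrDl -scalerAl linearP.
have L2 m : linear (fun l : H4 => h4_comul (m * l)).
  by move=> a x y; rewrite mulrDr -scalerAr linearP.
have L3 (m : H4) : linear (fun l : H4 => \sw_(h1, h2 <- h4_comul m)
    \sw_(l1, l2 <- h4_comul l) ((h1 * l1) ⊗ (h2 * l2))).
  move=> a x y; rewrite -tens_lift_fun; congr tens_lift.
  apply/funext => p; apply/funext => q; exact: (h4_sw_linear (iB p q)).
apply: (h4_linear_eq (L1 l) (h4_sw_linear (fB l))) => {h};
  apply: (h4_linear_eq (L2 _) (L3 _)) => {l} /=;
  rewrite ?(b1, bg, bn, bgn) ?(e1, eg, en, egn);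
  rewrite ?(mul1r, mulr1) ?(gg, gn, g_gn, ng, nn, n_gn, gn_g, gn_n, gn_gn);
  rewrite ?linearN /= ?(D1, Dg, Dn, Dgn) ?linear0 //;
  by rewrite ?(linearNl, linearNr, linear0l, linear0r) ?opprD ?(add0r, addr0)
    ?subrr ?addNr.
Qed.

Lemma h4_counit1 : h4_counit 1 = 1.
Proof. by case: h4_counit_basis. Qed.

Lemma h4_counitM h l : h4_counit (h * l) = h4_counit h * h4_counit l.
Proof.
rewrite -[h * l]/(h4_mul h l) h4_mulE /h4_counit /= /lin_table !sum_ord4 /=.
by rewrite !mxE /= /GRing.scale /=; ring.
Qed.

HB.instance Definition _ := hasHopf.Build R H4
  h4_comulA h4_counitl h4_counitr h4_comul1 h4_comulM h4_counit1 h4_counitM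
  h4_antipodel h4_antipoder.

End SweedlerH4Hopf.

(** The 1/4-quaternion algebra, in the basis [1, e_1, e_2, e_3]. *)

Definition quatH00 (R : comNzRingType) : Type := 'rV[R]_4.

Section QuatH00.
Variable R : comNzRingType.
Local Notation H00 := (quatH00 R).

HB.instance Definition _ := GRing.Lmodule.copy H00 'rV[R]_4.

Definition h00_one : H00 := delta_mx 0 (ord4 0).
Definition h00_e1 : H00 := delta_mx 0 (ord4 1).
Definition h00_e2 : H00 := delta_mx 0 (ord4 2).
Definition h00_e3 : H00 := delta_mx 0 (ord4 3).

Local Notation e1 := h00_e1.
Local Notation e2 := h00_e2.
Local Notation e3 := h00_e3.

Definition h00_mul : H00 -> H00 -> H00 := bilin_table
  [:: [:: h00_one;   e1; e2; e3];
      [::      e1;    0; e3;  0];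
      [::      e2; - e3;  0;  0];
      [::      e3;    0;  0;  0]].

Lemma h00_mulE (x y : H00) : h00_mul x y = \row_i
  [:: x 0 (ord4 0) * y 0 (ord4 0);
      x 0 (ord4 0) * y 0 (ord4 1) + x 0 (ord4 1) * y 0 (ord4 0);
      x 0 (ord4 0) * y 0 (ord4 2) + x 0 (ord4 2) * y 0 (ord4 0);
      x 0 (ord4 0) * y 0 (ord4 3) + x 0 (ord4 1) * y 0 (ord4 2)
      - x 0 (ord4 2) * y 0 (ord4 1) + x 0 (ord4 3) * y 0 (ord4 0)]`_i.
Proof.
rewrite /h00_mul /bilin_table !sum_ord4 /=.
by apply/rowP; apply: ord4P; rewrite !mxE /=; ring.
Qed.

Lemma h00_mulA : associative h00_mul.
Proof.
move=> x y z; rewrite !h00_mulE.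
by apply/rowP; apply: ord4P; rewrite !mxE /=; ring.
Qed.

Lemma h00_mul1 : left_id h00_one h00_mul.
Proof.
move=> x; rewrite !h00_mulE.
by apply/rowP; apply: ord4P; rewrite !mxE /=; ring.
Qed.

Lemma h00_mulr1 : right_id h00_one h00_mul.
Proof.
move=> x; rewrite !h00_mulE.
by apply/rowP; apply: ord4P; rewrite !mxE /=; ring.
Qed.

Lemma h00_mulDl : left_distributive h00_mul +%R.
Proof. by move=> x y z; rewrite /h00_mul linearDl. Qed.

Lemma h00_mulDr : right_distributive h00_mul +%R.
Proof. by move=> x y z; rewrite /h00_mul linearDr. Qed.

Lemma h00_one_neq0 : h00_one != 0.
Proof. by apply/eqP => /rowP/(_ (ord4 0))/eqP; rewrite !mxE /= oner_eq0. Qed.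

HB.instance Definition _ := GRing.Zmodule_isNzRing.Build H00
  h00_mulA h00_mul1 h00_mulr1 h00_mulDl h00_mulDr h00_one_neq0.

Lemma h00_scaleAl (a : R) (x y : H00) : a *: (x * y) = (a *: x) * y.
Proof. by rewrite -[RHS]/(h00_mul _ _) /h00_mul linearZl_LR. Qed.

HB.instance Definition _ := GRing.Lmodule_isLalgebra.Build R H00 h00_scaleAl.

Lemma h00_scaleAr (a : R) (x y : H00) : a *: (x * y) = x * (a *: y).
Proof. by rewrite -[RHS]/(h00_mul _ _) /h00_mul linearZr_LR. Qed.

HB.instance Definition _ := GRing.Lalgebra_isAlgebra.Build R H00 h00_scaleAr.

Lemma h00_mul_basis : [/\ [/\ e1 * e1 = 0, e2 * e2 = 0 & e3 * e3 = 0],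
  e1 * e2 = e3, e2 * e1 = - e3, e2 * e3 = 0 /\ e3 * e2 = 0 &
  e3 * e1 = 0 /\ e1 * e3 = 0].
Proof. by do ?split; apply: etrans (bilin_table_delta _ _ _) _. Qed.

End QuatH00.

(** In both tables, rows are indexed by the basis [1, g, ν, gν] of the Sweedler
    algebra, columns by the basis of the second factor. *)

Section SweedlerOnQuat.
Variables (R : comNzRingType) (k1 k2 k3 l1 l2 l3 l4 : R).
Local Notation H4 := (sweedlerH4 R).
Local Notation H00 := (quatH00 R).
Local Notation e1 := (h00_e1 R).
Local Notation e2 := (h00_e2 R).
Local Notation e3 := (h00_e3 R).

Let nu_1 : H00 := k1 *: e1 + k2 *: e2 + k3 *: e3.
Let gnu_1 : H00 := l1 *: 1 + l2 *: e1 + l3 *: e2 + l4 *: e3.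
Let nu_gnu : H00 :=
  (k1 * l1) *: e1 + (k2 * l1) *: e2 + (k3 * l1 - k2 * l2 + k1 * l3) *: e3.

Definition h4_h00_act_bilin : {bilinear H4 -> H00 -> H00} :=
  @bilin_table R H00 4 4
  [:: [:: 1;     e1;                      e2;                      e3];
      [:: 0;     0;                       0;                       0];
      [:: nu_1;  - k2 *: e3;              k1 *: e3;                0];
      [:: gnu_1; l1 *: e1 + l3 *: e3;     l1 *: e2 - l2 *: e3;     l1 *: e3]].

Definition h4_h00_act : {linear (H4 ⊗ H00)%type -> H00} :=
  tens_lift h4_h00_act_bilin.

Definition h4_h00_omega_bilin : {bilinear H4 -> H4 -> H00} :=
  @bilin_table R H00 4 4
  [:: [:: 1;     0; nu_1;   gnu_1];
      [:: 0;     0; 0;      0];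
      [:: nu_1;  0; 0;      nu_gnu];
      [:: gnu_1; 0; nu_gnu; 0]].

Definition h4_h00_omega : {linear (H4 ⊗ H4)%type -> H00} :=
  tens_lift h4_h00_omega_bilin.

End SweedlerOnQuat.

(* Main.v *)
Require Import Defs.
From mathcomp Require Import all_boot all_order all_algebra.
From mathcomp Require Import boolp reals.
From mathcomp Require Import ring.

(** In closed form, with [n := k1 e1 + k2 e2 + k3 e3] and
    [m := l1 1 + l2 e1 + l3 e2 + l4 e3], the action is
      [1 . a = a],  [g . a = 0],  [ν . a = n a],  [gν . a = a m],
    and ω is unital up to the action ([ω(1, h) = ω(h, 1) = h . 1]), is zero as
    soon as one argument is [g], and satisfies
      [ω(ν, gν) = ω(gν, ν) = n m],  [ω(ν, ν) = ω(gν, gν) = 0].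
    For any algebra [A] and any two elements [n], [m] of [A], such formulas give
    a twisted partial action if [n n = 0] ([twisted_partial_action_of_sq0]).
    Since [g] acts by zero, only [ν (x) 1] and [1 (x) gν] matter in the
    multiplicativity axiom: [ν] acts like a left multiplication and [gν] like a
    right one, so that axiom is associativity.  In the twisting and
    cocycle axioms all pairs of basis elements but two reduce to
    [(n a) m = n (a m)] or to unit and zero laws.  The pair [(gν, gν)] works because the
    terms with [gν g = - ν] and [g gν = ν] cancel, and the pair [(ν, ν)] of the
    twisting axiom is exactly [n (n a) = 0].  In the 1/4-quaternion algebra the
    square of any element of the span of [e1, e2, e3] vanishes, because [e1] and
    [e2] anticommute and have square zero, while [e3] annihilates all three. *)

Set Implicit Arguments.
Unset Strict Implicit.
Unset Printing Implicit Defensive.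

Import GRing.Theory.
Local Open Scope ring_scope.

(** * Bilinearity of Sweedler sums *)

Section Bilinearity.
Variable R : comNzRingType.

Lemma linear_tensl (U V W : lmodType R) (T : {linear (U ⊗ V)%type -> W}) v :
  linear (fun u => T (u ⊗ v)).
Proof. by move=> a x y; rewrite linearPl linearP. Qed.

Lemma linear_tensr (U V W : lmodType R) (T : {linear (U ⊗ V)%type -> W}) u :
  linear (fun v => T (u ⊗ v)).
Proof. by move=> a x y; rewrite linearPr linearP. Qed.

Lemma bilinear_map_mul (U V : lmodType R) (A : algType R)
    (f : U -> A) (g : V -> A) :
  linear f -> linear g -> bilinear_map (fun u v => f u * g v).
Proof.
by move=> fL gL; split=> z a x y /=;
  rewrite ?fL ?gL ?mulrDl ?mulrDr -?scalerAl -?scalerAr.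
Qed.

Lemma bilinear_map_sw (H : hopfType R) (W : lmodType R)
    (F : H -> H -> H -> H -> W) l :
  (forall l1 l2, bilinear_map (fun h1 h2 => F h1 h2 l1 l2)) ->
  bilinear_map (fun h1 h2 => \sw_(l1, l2 <- comul l) F h1 h2 l1 l2).
Proof.
move=> FB; split=> z b u v /=; rewrite -tens_lift_fun; congr tens_lift;
  apply/funext => p; apply/funext => q.
  exact: (FB p q).1.
exact: (FB p q).2.
Qed.

(** Both sides of the twisting and cocycle axioms have this form, so they are
    bilinear in [(h, l)] and can be compared on pairs of basis elements. *)
Lemma bilinear_map_sw2 (H : hopfType R) (W : lmodType R)
    (F : H -> H -> H -> H -> W) :
  (forall l1 l2, bilinear_map (fun h1 h2 => F h1 h2 l1 l2)) ->
  (forall h1 h2, bilinear_map (F h1 h2)) ->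
  bilinear_map (fun h l =>
    \sw_(h1, h2 <- comul h) \sw_(l1, l2 <- comul l) F h1 h2 l1 l2).
Proof.
move=> Fh Fl; split=> [l | h] a x y /=.
  by rewrite linearP tens_lift_linear//; apply: bilinear_map_sw.
rewrite -tens_lift_fun; congr tens_lift; apply/funext => p; apply/funext => q.
by rewrite linearP tens_lift_linear.
Qed.

End Bilinearity.

(** * Twisted partial actions of the Sweedler algebra with g acting by zero *)

Section SweedlerTwistedPartialAction.
Variable R : comNzRingType.
Local Notation H4 := (sweedlerH4 R).
Local Notation g := (h4_g R : H4).
Local Notation ν := (h4_nu R : H4).
Local Notation gν := (h4_gnu R : H4).

Lemma h4_bilinear_eq (W : lmodType R) (F G : H4 -> H4 -> W) :
  bilinear_map F -> bilinear_map G ->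
  (forall h l : H4, h \in [:: 1; g; ν; gν] -> l \in [:: 1; g; ν; gν] ->
    F h l = G h l) ->
  forall h l, F h l = G h l.
Proof.
move=> FB GB FG h l.
have {}FG h' : h' \in [:: 1; g; ν; gν] -> F h' l = G h' l.
  by move=> hb; apply: (h4_linear_eq (FB.2 h') (GB.2 h'));
    apply: FG; rewrite ?hb // !inE eqxx ?orbT.
by apply: (h4_linear_eq (FB.1 l) (GB.1 l)); apply: FG;
  rewrite !inE eqxx ?orbT.
Qed.

(** Stated with products of equations, so that each part is a single rewrite
    rule that expands every Sweedler sum of the form [S] or [T]. *)
Lemma h4_sw2_basis (W : lmodType R) (F : H4 -> H4 -> H4 -> H4 -> W) :
  (forall l1 l2, bilinear_map (fun h1 h2 => F h1 h2 l1 l2)) ->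
  (forall h1 h2, bilinear_map (F h1 h2)) ->
  let S h l :=
    \sw_(h1, h2 <- comul h) \sw_(l1, l2 <- comul l) F h1 h2 l1 l2 in
  let T h1 h2 l := \sw_(l1, l2 <- comul l) F h1 h2 l1 l2 in
  (forall l, (S 1 l = T 1 1 l) * (S g l = T g g l) *
             (S ν l = T g ν l + T ν 1 l) * (S gν l = T 1 gν l + T gν g l)) *
  (forall x y, (T x y 1 = F x y 1 1) * (T x y g = F x y g g) *
               (T x y ν = F x y g ν + F x y ν 1) *
               (T x y gν = F x y 1 gν + F x y gν g)).
Proof.
move=> Fh Fl S T; split=> [l | x y]; last by case: (h4_sw_basis (Fl x y)).
by case: (h4_sw_basis (bilinear_map_sw l Fh)).
Qed.

Variables (A : algType R) (n m : A).
Variables (act : {linear (H4 ⊗ A)%type -> A})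
          (omega : {linear (H4 ⊗ H4)%type -> A}).

(** The square of [n] enters through one comparison only, that of
    [ν . (ν . a) = n (n a)] with [ω(ν, ν) a = 0] in the twisting axiom. *)
Lemma twisted_partial_action_of_sq0 :
  n * n = 0 ->
  (forall a, [/\ act (1 ⊗ a) = a, act (g ⊗ a) = 0,
                 act (ν ⊗ a) = n * a & act (gν ⊗ a) = a * m]) ->
  [/\ [/\ omega (1 ⊗ 1) = 1, omega (1 ⊗ g) = 0,
          omega (1 ⊗ ν) = n & omega (1 ⊗ gν) = m],
      [/\ omega (g ⊗ 1) = 0, omega (g ⊗ g) = 0,
          omega (g ⊗ ν) = 0 & omega (g ⊗ gν) = 0],
      [/\ omega (ν ⊗ 1) = n, omega (ν ⊗ g) = 0,
          omega (ν ⊗ ν) = 0 & omega (ν ⊗ gν) = n * m] &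
      [/\ omega (gν ⊗ 1) = m, omega (gν ⊗ g) = 0,
          omega (gν ⊗ ν) = n * m & omega (gν ⊗ gν) = 0]] ->
  twisted_partial_action act omega.
Proof.
move=> nn0 actE [[o11 o1g o1n o1gn] [og1 ogg ogn oggn]].
move=> [on1 ong onn ongn] [ogn1 ogng ognn ogngn].
have a1 a : act (1 ⊗ a) = a by case: (actE a).
have ag a : act (g ⊗ a) = 0 by case: (actE a).
have an a : act (ν ⊗ a) = n * a by case: (actE a).
have agn a : act (gν ⊗ a) = a * m by case: (actE a).
have anN a : act (- ν ⊗ a) = - (n * a) by rewrite linearNl linearN an.
have agnN a : act (- gν ⊗ a) = - (a * m) by rewrite linearNl linearN agn.
have a0 a : act ((0 : H4) ⊗ a) = 0 by rewrite linear0l linear0.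
have [[gg gn g_gn] [ng nn n_gn] [gn_g gn_n gn_gn]] := h4_mul_basis R.
have oB : bilinear_map (fun h l : H4 => omega (h ⊗ l)).
  by split=> z; [exact: linear_tensl|exact: linear_tensr].
have mulB b : bilinear_map (fun h l : H4 => act ((h * l) ⊗ b)).
  by split=> z c u v /=; rewrite ?mulrDl ?mulrDr -?scalerAl -?scalerAr
    (linear_tensl act b).
have actB b : bilinear_map (fun h l : H4 => act (h ⊗ act (l ⊗ b))).
  by split=> z c u v /=; rewrite ?(linear_tensl act b)
    ?(linear_tensl act (act _)) ?(linear_tensr act z).
(* The summands of the two sides of the twisting axiom at [b]; those of the
   cocycle axiom are [Q 1]. *)
pose L b (h1 h2 l1 l2 : H4) := act (h1 ⊗ act (l1 ⊗ b)) * omega (h2 ⊗ l2).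
pose Q b (h1 h2 l1 l2 : H4) := omega (h1 ⊗ l1) * act ((h2 * l2) ⊗ b).
have Lh b l1 l2 : bilinear_map (fun h1 h2 => L b h1 h2 l1 l2).
  by apply: bilinear_map_mul; [exact: (actB b).1|exact: oB.1].
have Ll b h1 h2 : bilinear_map (L b h1 h2).
  by apply: bilinear_map_mul; [exact: (actB b).2|exact: oB.2].
have Qh b l1 l2 : bilinear_map (fun h1 h2 => Q b h1 h2 l1 l2).
  by apply: bilinear_map_mul; [exact: oB.1|exact: (mulB b).1].
have Ql b h1 h2 : bilinear_map (Q b h1 h2).
  by apply: bilinear_map_mul; [exact: oB.2|exact: (mulB b).2].
have mulE := (mul1r, mulr1, gg, gn, g_gn, ng, nn, n_gn, gn_g, gn_n, gn_gn).
have actE' := (a1, ag, an, agn, anN, agnN, a0).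
have omegaE := (o11, o1g, o1n, o1gn, og1, ogg, ogn, oggn,
                on1, ong, onn, ongn, ogn1, ogng, ognn, ogngn).
split=> [a | h a b | h l a | h l].
- exact: a1.
- have fB : bilinear_map (fun h1 h2 : H4 => act (h1 ⊗ a) * act (h2 ⊗ b)).
    by apply: bilinear_map_mul; exact: linear_tensl.
  have [f1 fg fn fgn] := h4_sw_basis fB.
  apply: (h4_linear_eq (linear_tensl act (a * b)) (h4_sw_linear fB)).
  + by rewrite f1 !a1.
  + by rewrite fg !ag mul0r.
  + by rewrite fn !actE' mul0r add0r mulrA.
  + by rewrite fgn !actE' mulr0 addr0 mulrA.
- apply: (h4_bilinear_eq (bilinear_map_sw2 (Lh a) (Ll a))
                         (bilinear_map_sw2 (Qh a) (Ql a))) => h' l'.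
  have SL := h4_sw2_basis (Lh a) (Ll a); have SQ := h4_sw2_basis (Qh a) (Ql a).
  rewrite !inE => /or4P[] /eqP-> /or4P[] /eqP->; rewrite !SL !SQ /L /Q;
    rewrite !(mulE, actE', omegaE) ?(mul0r, mulr0, add0r, addr0) //;
    (* What is left is associativity, [n (n a) = 0] for the pair [(ν, ν)], and
       the cancellation [- m (n a) + m (n a) = 0] for the pair [(gν, gν)]. *)
    by rewrite ?mulrN ?addNr ?mulrA ?nn0 ?mul0r.
- apply: (h4_bilinear_eq oB (bilinear_map_sw2 (Qh 1) (Ql 1))) => h' l'.
  have SQ := h4_sw2_basis (Qh 1) (Ql 1).
  rewrite !inE => /or4P[] /eqP-> /or4P[] /eqP->; rewrite !SQ /Q;
    rewrite !(mulE, actE', omegaE) ?(mul0r, mulr0, add0r, addr0) //;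
    by rewrite ?mulrN ?addNr.
Qed.

End SweedlerTwistedPartialAction.

(** * The action on the 1/4-quaternion algebra *)

Lemma bilin_table_deltal (R : comNzRingType) (W : lmodType R) p q
    (t : seq (seq W)) (i : 'I_p) (y : 'rV[R]_q) :
  bilin_table t (delta_mx 0 i) y = lin_table (nth [::] t i) y.
Proof.
rewrite /bilin_table (bigD1 i) //= [X in _ + X]big1 ?addr0 => [|k ki]; last first.
  by rewrite big1 // => j _; rewrite !mxE eqxx (negbTE ki) mul0r scale0r.
by apply: eq_bigr => j _; rewrite !mxE !eqxx mul1r.
Qed.

Section QuatH00Action.
Variables (R : comNzRingType) (k1 k2 k3 l1 l2 l3 l4 : R).
Local Notation H4 := (sweedlerH4 R).
Local Notation H00 := (quatH00 R).
Local Notation g := (h4_g R : H4).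
Local Notation ν := (h4_nu R : H4).
Local Notation gν := (h4_gnu R : H4).
Local Notation e1 := (h00_e1 R : H00).
Local Notation e2 := (h00_e2 R : H00).
Local Notation e3 := (h00_e3 R : H00).
Local Notation act := (h4_h00_act k1 k2 k3 l1 l2 l3 l4).
Local Notation omega := (h4_h00_omega k1 k2 k3 l1 l2 l3 l4).

Let n : H00 := k1 *: e1 + k2 *: e2 + k3 *: e3.
Let m : H00 := l1 *: 1 + l2 *: e1 + l3 *: e2 + l4 *: e3.

Lemma h00_mul_row (x y : H00) : x * y = h00_mul x y.
Proof. by []. Qed.

Lemma h00_span_sq0 : n * n = 0.
Proof.
rewrite h00_mul_row h00_mulE /n.
by apply/rowP; apply: ord4P; rewrite !mxE /=; ring.
Qed.

(** The value that the table of ω prescribes at [(ν, gν)] and [(gν, ν)] is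
    the product of those at [(ν, 1)] and [(gν, 1)]. *)
Lemma h00_span_mul : n * m =
  (k1 * l1) *: e1 + (k2 * l1) *: e2 + (k3 * l1 - k2 * l2 + k1 * l3) *: e3.
Proof.
rewrite h00_mul_row h00_mulE /n /m.
by apply/rowP; apply: ord4P; rewrite !mxE /=; ring.
Qed.

(** Multiplicativity forces this shape: as [g] acts by zero, [ν . (1 a)] is
    [(ν . 1) a] and [gν . (a 1)] is [a (gν . 1)]. *)
Lemma h4_h00_actE (a : H00) : [/\ act (1 ⊗ a) = a, act (g ⊗ a) = 0,
  act (ν ⊗ a) = n * a & act (gν ⊗ a) = a * m].
Proof.
have actE h : act (h ⊗ a) = h4_h00_act_bilin k1 k2 k3 l1 l2 l3 l4 h a.
  by apply: tens_lift_tens; apply: bilinear_mapP.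
split; rewrite actE [LHS]bilin_table_deltal /lin_table sum_ord4 /=.
- by apply/rowP; apply: ord4P; rewrite !mxE /=; ring.
- by rewrite !scaler0 !addr0.
- rewrite h00_mul_row h00_mulE /n.
  by apply/rowP; apply: ord4P; rewrite !mxE /=; ring.
- rewrite h00_mul_row h00_mulE /m.
  by apply/rowP; apply: ord4P; rewrite !mxE /=; ring.
Qed.

Lemma h4_h00_omega_basis :
  [/\ [/\ omega (1 ⊗ 1) = 1, omega (1 ⊗ g) = 0,
          omega (1 ⊗ ν) = n & omega (1 ⊗ gν) = m],
      [/\ omega (g ⊗ 1) = 0, omega (g ⊗ g) = 0,
          omega (g ⊗ ν) = 0 & omega (g ⊗ gν) = 0],
      [/\ omega (ν ⊗ 1) = n, omega (ν ⊗ g) = 0,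
          omega (ν ⊗ ν) = 0 & omega (ν ⊗ gν) = n * m] &
      [/\ omega (gν ⊗ 1) = m, omega (gν ⊗ g) = 0,
          omega (gν ⊗ ν) = n * m & omega (gν ⊗ gν) = 0]].
Proof.
have omegaE h l : omega (h ⊗ l) = h4_h00_omega_bilin k1 k2 k3 l1 l2 l3 l4 h l.
  by apply: tens_lift_tens; apply: bilinear_mapP.
rewrite h00_span_mul; do ?split; rewrite omegaE.
all: by apply: etrans (bilin_table_delta _ _ _) _.
Qed.

End QuatH00Action.

Theorem theorem5p1 (R : realType) (k1 k2 k3 l1 l2 l3 l4 : R) :
  @twisted_partial_action R (sweedlerH4 R) (quatH00 R)
    (h4_h00_act k1 k2 k3 l1 l2 l3 l4) (h4_h00_omega k1 k2 k3 l1 l2 l3 l4).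
Proof.
exact: (twisted_partial_action_of_sq0 (h00_span_sq0 k1 k2 k3)
  (h4_h00_actE k1 k2 k3 l1 l2 l3 l4)
  (h4_h00_omega_basis k1 k2 k3 l1 l2 l3 l4)).
Qed.
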